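(* Let $L$ be a Leibniz algebra over a field $\mathbb{K}$ and let $G$ be a finite group acting on $L$. If $a\in L$ is a CL-element, then $ga$ is a CL-element of $L$ for every $g\in G$.
   Context: A Leibniz algebra over a field $\mathbb{K}$ is a $\mathbb{K}$-vector space $L$ with a $\mathbb{K}$-bilinear bracket $[\cdot,\cdot]:L\times L\to L$ satisfying $[x,[y,z]]=[[x,y],z]-[[x,z],y]$ for all $x,y,z\in L$. The centralizer of $x\in L$ is $C_L(x)=\{y\in L\mid [x,y]=0=[y,x]\}$. An element $a\in L$ has the left CL-property if $[[x,a],y]=0$ and $[[a,x],y]=0$ for all $x\in L$ and all $y\in C_L(x)$; it has the right CL-property if $[[x,a],y]=0$ and $[y,[a,x]]=0$ for all $x\in L$ and all $y\in C_L(x)$. It has the CL-property, and is called a CL-element, if it has both. A finite group $G$ acts on $L$ (from the left) if there is a function $G\times L\to L$, $(g,x)\mapsto gx$, such that: for each $g\in G$ the map $x\mapsto gx$ is linear; $ex=x$ for all $x\in L$, where $e$ is the identity of $G$; $g_1(g_2x)=(g_1g_2)x$ for all $g_1,g_2\in G$, $x\in L$; and $g[x,y]=[gx,gy]$ for all $g\in G$, $x,y\in L$. *)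

(* Defs.v *)
From mathcomp Require Import all_boot all_algebra all_fingroup.

Set Implicit Arguments.
Unset Strict Implicit.
Unset Printing Implicit Defensive.

Import GRing.Theory.
Local Open Scope ring_scope.

(* The (right) Leibniz identity: each map [-, z] is a derivation. *)
Definition leibniz_identity (V : zmodType) (br : V -> V -> V) : Prop :=
  forall x y z : V, br x (br y z) = br (br x y) z - br (br x z) y.

Record leibnizAlgebra (K : fieldType) := LeibnizAlgebra {
  carrier :> lmodType K;
  bracket : {bilinear carrier -> carrier -> carrier};
  bracket_leibniz : leibniz_identity bracket
}.

Declare Scope leibniz_scope.
Delimit Scope leibniz_scope with leibniz.
Notation "[< x , y >]" := (bracket _ x y)
  (at level 0, x, y at level 99, format "[<  x ,  y  >]") : leibniz_scope.
Local Open Scope leibniz_scope.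

Definition centralizer (K : fieldType) (L : leibnizAlgebra K) (x : L) : L -> Prop :=
  fun y => [< x, y >] = 0 /\ [< y, x >] = 0.

Definition left_CL (K : fieldType) (L : leibnizAlgebra K) (a : L) : Prop :=
  forall x y : L, centralizer x y ->
    [< [< x, a >], y >] = 0 /\ [< [< a, x >], y >] = 0.

Definition right_CL (K : fieldType) (L : leibnizAlgebra K) (a : L) : Prop :=
  forall x y : L, centralizer x y ->
    [< [< x, a >], y >] = 0 /\ [< y, [< a, x >] >] = 0.

Definition CL_element (K : fieldType) (L : leibnizAlgebra K) (a : L) : Prop :=
  left_CL a /\ right_CL a.

(* The actions of the library's action.v are right actions on bare types. *)
Record leibnizAction (G : finGroupType) (K : fieldType) (L : leibnizAlgebra K) :=
  LeibnizAction {
  lact :> G -> L -> L;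
  lact_linear : forall g : G, linear (lact g);
  lact1 : forall x : L, lact 1%g x = x;
  lactM : forall (g1 g2 : G) (x : L), lact g1 (lact g2 x) = lact (g1 * g2)%g x;
  lact_bracket : forall (g : G) (x y : L),
    lact g [< x, y >] = [< lact g x, lact g y >]
}.

(* Main.v *)
Require Import Defs.
From mathcomp Require Import all_boot all_algebra all_fingroup.

(** Each $g$ acts as an automorphism of $L$ with inverse $g^{-1}$, so the CL-conditions are
    transported along it. If $y$ centralizes $x$, then $g^{-1}y$ centralizes $g^{-1}x$
    ([centralizer_lact]), and $[[x,ga],y]=g[[g^{-1}x,a],g^{-1}y]=g0=0$; the other brackets are
    alike. *)

Lemma lact0 {K : fieldType} {L : leibnizAlgebra K} {G : finGroupType}
  (act : leibnizAction G L) (g : G) : act g 0%R = 0%R.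
Proof.
(* With scalar $-1$ and both vectors zero, linearity reads $g0=-g0+g0$. *)
have /= := lact_linear act g (-1)%R 0%R 0%R.
by rewrite GRing.scaler0 GRing.addr0 GRing.scaleN1r GRing.addNr.
Qed.

Lemma lactKV {K : fieldType} {L : leibnizAlgebra K} {G : finGroupType}
  (act : leibnizAction G L) (g : G) (x : L) : act g (act g^-1%g x) = x.
Proof. by rewrite lactM mulgV lact1. Qed.

Lemma centralizer_lact {K : fieldType} {L : leibnizAlgebra K} {G : finGroupType}
  (act : leibnizAction G L) (g : G) {x y : L} :
  centralizer x y -> centralizer (act g x) (act g y).
Proof. by case=> xy0 yx0; split; rewrite -lact_bracket ?xy0 ?yx0 lact0. Qed.

Theorem theorem5p6 (K : fieldType) (L : leibnizAlgebra K) (G : finGroupType)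
  (act : leibnizAction G L) (a : L) :
  CL_element a -> forall g : G, CL_element (act g a).
Proof.
case=> la ra g; split=> x y /(centralizer_lact act g^-1%g) cxy.
- have [xay axy] := la _ _ cxy.
  (* Writing $x=g(g^{-1}x)$ and $y=g(g^{-1}y)$ lets $g$ be pulled out of both nested brackets. *)
  by rewrite -(lactKV act g x) -(lactKV act g y) -!lact_bracket xay axy lact0.
- have [xay yax] := ra _ _ cxy.
  by rewrite -(lactKV act g x) -(lactKV act g y) -!lact_bracket xay yax lact0.
Qed.
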